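(* Let $U\subseteq\mathbb{R}^n$ be a star-shaped open set, let $\omega\in\Omega^1(U)$ be a nowhere-vanishing 1-form on $U$ which is Frobenius integrable, i.e. $d\omega\wedge\omega=0$, and let $\mathcal{Z}=\mathcal{S}(\{\omega\})^{\perp}$ be the corank 1 involutive distribution of all smooth vector fields $Z$ on $U$ with $Z\,\lrcorner\,\omega=0$. Let $X$ be a $\mathcal{C}^{\infty}$-symmetry of $\mathcal{Z}$ such that $X\,\lrcorner\,\omega=1$ on $U$. Then a non-vanishing smooth function $f$ on $U$ is a symmetrizing factor for $X$ with respect to $\mathcal{Z}$ if and only if $\mu=1/f$ is an integrating factor for $\omega$.
   Context: $\lrcorner$ denotes contraction (interior product) of a vector field with a differential form. Vector fields (or 1-forms) are called independent on $U$ if they are pointwise linearly independent at every point of $U$. $\mathcal{S}(B)$ denotes the $\mathcal{C}^\infty(U)$-submodule of the smooth vector fields (or 1-forms) on $U$ generated by $B$. A rank $r$ distribution on $U$ is a submodule $\mathcal{S}(\{Z_1,\ldots,Z_r\})$ with $Z_1,\ldots,Z_r$ independent vector fields on $U$; its corank is $n-r$; it is involutive if it is closed under the Lie bracket. The kernel $\mathcal{S}(\{\omega\})^{\perp}$ above is a distribution of rank $n-1$. Let $\mathcal{Z}=\mathcal{S}(\{Z_1,\ldots,Z_r\})$ be an involutive distribution of rank $r<n$. A vector field $X$ on $U$ such that $\{Z_1,\ldots,Z_r,X\}$ is independent on $U$ is a $\mathcal{C}^{\infty}$-symmetry of $\mathcal{Z}$ if $\mathcal{S}(\{Z_1,\ldots,Z_r,X\})$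 is involutive, i.e. there are smooth functions $\lambda_i,c_{ik}$ on $U$ with $[X,Z_i]=\lambda_iX+\sum_{k=1}^r c_{ik}Z_k$ for $1\le i\le r$. It is a symmetry of $\mathcal{Z}$ if moreover all $\lambda_i=0$. A non-vanishing smooth function $f$ on $U$ is a symmetrizing factor of the $\mathcal{C}^{\infty}$-symmetry $X$ with respect to $\mathcal{Z}$ if $fX$ is a symmetry of $\mathcal{Z}$. A (non-vanishing) smooth function $\mu$ on $U$ is an integrating factor for $\omega$ if $\mu\omega$ is exact on $U$, i.e. $\mu\omega=dF$ for some $F\in\mathcal{C}^\infty(U)$. *)

(* Defs.v *)
From HB Require Import structures.
From mathcomp Require Import all_boot all_order all_algebra.
From mathcomp Require Import all_classical all_reals all_analysis.

Set Implicit Arguments.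
Unset Strict Implicit.
Unset Printing Implicit Defensive.

Import Order.TTheory GRing.Theory Num.Theory.
Import numFieldNormedType.Exports.
Local Open Scope classical_set_scope.
Local Open Scope ring_scope.

(* Functions, vector fields and forms on an open set U of R^n are total
   functions on 'rV[R]_n.  Every predicate and operation below depends, on U,
   only on the restriction to U (partial derivatives are local). *)

Section Calculus.
Context {R : realType} {n : nat}.
Local Notation E := 'rV[R]_n.

Definition star_shaped (U : set E) : Prop :=
  exists2 x0 : E, U x0 &
    forall (x : E) (t : R), U x -> 0 <= t <= 1 -> U (x0 + t *: (x - x0)).

Definition partial (i : 'I_n) (g : E -> R) : E -> R :=
  fun x => 'D_(delta_mx 0 i) g x.

Definition iter_partial (s : seq 'I_n) (g : E -> R) : E -> R :=
  foldr partial g s.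

(* C^oo: partial derivatives of all orders exist and are continuous on U. *)
Definition smooth (U : set E) (g : E -> R) : Prop :=
  forall (s : seq 'I_n) (x : E), U x ->
    {for x, continuous (iter_partial s g)} /\
    forall i, derivable (iter_partial s g) x (delta_mx 0 i).

(* The vector field \sum_i X_i d/dx_i is the row of the X_i, the 1-form
   \sum_i w_i dx_i is the column of the w_i. *)
Definition vfield : Type := E -> 'rV[R]_n.
Definition form1 : Type := E -> 'cV[R]_n.

Definition smooth_vfield (U : set E) (X : vfield) : Prop :=
  forall i, smooth U (fun x => X x 0 i).

Definition smooth_form1 (U : set E) (w : form1) : Prop :=
  forall i, smooth U (fun x => w x i 0).

Definition interior_product (X : vfield) (w : form1) : E -> R :=
  fun x => \sum_i X x 0 i * w x i 0.

Definition vf_apply (X : vfield) (g : E -> R) : E -> R :=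
  fun x => \sum_i X x 0 i * partial i g x.

Definition vf_scale (g : E -> R) (X : vfield) : vfield :=
  fun x => g x *: X x.

Definition lie_bracket (X Y : vfield) : vfield :=
  fun x => \row_j (vf_apply X (fun y => Y y 0 j) x
                   - vf_apply Y (fun y => X y 0 j) x).

Definition d0 (g : E -> R) : form1 := fun x => \col_i partial i g x.

(* Entry (i, j) is the value of the 2-form on (d/dx_i, d/dx_j). *)
Definition d1 (w : form1) : E -> 'M[R]_n :=
  fun x => \matrix_(i, j) (partial i (fun y => w y j 0) x
                           - partial j (fun y => w y i 0) x).

(* Value on (d/dx_i, d/dx_j, d/dx_k) of the wedge product of a 2-form and a
   1-form: (a /\ b)(u,v,w) = a(u,v) b(w) + a(v,w) b(u) + a(w,u) b(v). *)
Definition wedge21 (a : E -> 'M[R]_n) (b : form1) (x : E) (i j k : 'I_n) : R :=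
  a x i j * b x k 0 + a x j k * b x i 0 + a x k i * b x j 0.

Definition frobenius_integrable (U : set E) (w : form1) : Prop :=
  forall x, U x -> forall i j k, wedge21 (d1 w) w x i j k = 0.

Definition exact_form1 (U : set E) (w : form1) : Prop :=
  exists2 F : E -> R, smooth U F & forall x, U x -> w x = d0 F x.

Definition integrating_factor (U : set E) (w : form1) (mu : E -> R) : Prop :=
  [/\ smooth U mu, forall x, U x -> mu x != 0 &
      exact_form1 U (fun x => mu x *: w x)].

End Calculus.

Arguments vfield R n : clear implicits.
Arguments form1 R n : clear implicits.

Section Distributions.
Context {R : realType} {n : nat}.
Local Notation E := 'rV[R]_n.
Local Notation vfield := (vfield R n).

Definition independent_on (U : set E) (r : nat) (B : 'I_r -> vfield) : Prop :=
  forall x, U x -> row_free (\matrix_(i < r) B i x).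

(* The C^oo(U)-submodule S(B). *)
Definition span_vf (U : set E) (r : nat) (B : 'I_r -> vfield) : set vfield :=
  [set Y | exists2 a : 'I_r -> E -> R, forall i, smooth U (a i) &
     forall x, U x -> Y x = \sum_i a i x *: B i x].

(* S({w})^\perp; a field killed by w is killed by every multiple of w *)
Definition annihilator (U : set E) (w : form1 R n) : set vfield :=
  [set Z | smooth_vfield U Z /\ forall x, U x -> interior_product Z w x = 0].

Definition involutive_on (U : set E) (D : set vfield) : Prop :=
  forall Y1 Y2, D Y1 -> D Y2 -> D (lie_bracket Y1 Y2).

Definition extend (r : nat) (Z : 'I_r -> vfield) (X : vfield) :
    'I_(r + 1) -> vfield :=
  fun i => match fintype.split i with inl k => Z k | inr _ => X end.

(* D is the involutive distribution S({Z_1, ..., Z_r}) of rank r < n. *)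
Definition involutive_distribution (U : set E) (D : set vfield)
    (r : nat) (Z : 'I_r -> vfield) : Prop :=
  [/\ (r < n)%N, forall i, smooth_vfield U (Z i), independent_on U Z,
      D = span_vf U Z & involutive_on U D].

Definition cinf_symmetry_frame (U : set E) (r : nat) (Z : 'I_r -> vfield)
    (X : vfield) : Prop :=
  [/\ smooth_vfield U X, independent_on U (extend Z X) &
      involutive_on U (span_vf U (extend Z X))].

Definition cinf_symmetry (U : set E) (D : set vfield) (X : vfield) : Prop :=
  exists r (Z : 'I_r -> vfield),
    involutive_distribution U D Z /\ cinf_symmetry_frame U Z X.

(* All the coefficients of X in the brackets [X, Z_i] vanish. *)
Definition symmetry (U : set E) (D : set vfield) (X : vfield) : Prop :=
  exists r (Z : 'I_r -> vfield),
    [/\ involutive_distribution U D Z, cinf_symmetry_frame U Z X &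
        forall i, exists2 c : 'I_r -> E -> R, forall k, smooth U (c k) &
          forall x, U x ->
            lie_bracket X (Z i) x = \sum_k c k x *: Z k x].

Definition symmetrizing_factor (U : set E) (D : set vfield) (X : vfield)
    (f : E -> R) : Prop :=
  [/\ smooth U f, forall x, U x -> f x != 0 & symmetry U D (vf_scale f X)].

End Distributions.

(* Main.v *)
From HB Require Import structures.
Require Import Defs.
From mathcomp Require Import all_boot all_order all_algebra.
From mathcomp Require Import all_classical all_reals all_analysis.
From mathcomp Require Import ring lra.
Import Order.TTheory GRing.Theory Num.Theory.
Import numFieldNormedType.Exports.
Local Open Scope classical_set_scope.
Local Open Scope ring_scope.

(* Put [eta = omega / f] and [Y = f X], so that [Y _| eta = 1], while
   [Z _| eta = 0] for every [Z] in the annihilator of [omega].  Cartan's formula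
   gives [d eta (Y, Z) = - [Y, Z] _| eta].  If [eta = dF], the left-hand side
   vanishes, so [[Y, Z]] annihilates [omega].  Conversely, if all brackets
   [[Y, Z_i]] annihilate [omega], then [Y _| d eta = 0], and contracting
   [d eta /\ eta = 0] with [Y] gives [d eta = 0]; the Poincare lemma on the
   star-shaped set [U] makes [eta] exact. *)

(** Cartan's formula reduces to its bracket term because [Y _| eta] and [Z _| eta] are constants on
    [U], so their derivatives vanish; this is the purpose of dividing [omega] by [f]. It controls
    [Y _| d eta] only on [Y] and on the [Z_i], whereas the vanishing of a 1-form must be tested on
    all coordinate fields. The normalisation [X _| omega = 1] closes the gap: the k-th coordinate
    field minus [omega_k X] lies in the annihilator, which is the span of the [Z_i]. In the converse
    direction the same equality of annihilator and span turns a bracket killed by [omega] into a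
    combination of the [Z_i] with smooth coefficients. Smoothness is stated through iterated
    coordinate partials alone. Total differentiability (hence derivatives along arbitrary
    directions), the symmetry of second partials and the smoothness of a primitive must therefore be
    derived from mean value estimates before the calculus of forms can start. *)

Lemma is_derive_lineP {R : realType} {V : normedModType R} {g : V -> R}
    {p v : V} {s d : R} :
  is_derive (p + s *: v) v g d <->
  is_derive s 1 (fun r : R => g (p + r *: v)) d.
Proof.
have E : (fun h : R => h^-1 *: (g (p + (h *: (1 : R) + s) *: v)
            - g (p + s *: v)))
       = (fun h : R => h^-1 *: (g (h *: v + (p + s *: v)) - g (p + s *: v))).
  apply/funext => h; congr (_ *: (g _ - _)).
  by rewrite scalerDl addrCA [_ *: 1](mulr1 h).
by split=> -[dg dgE]; split; move: dg dgE; rewrite /derivable /derive/= E.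
Qed.

Lemma is_derive_translate (R : realType) (V : normedModType R) (g : V -> R)
    (w y v : V) (d : R) :
  is_derive (w + y) v g d -> is_derive y v (fun z => g (w + z)) d.
Proof.
have E : (fun h : R => h^-1 *: (g (w + (h *: v + y)) - g (w + y)))
       = (fun h : R => h^-1 *: (g (h *: v + (w + y)) - g (w + y))).
  by apply/funext => h; rewrite addrCA.
case=> dg dgE; split; first by rewrite /derivable/= E.
by rewrite /derive/= E.
Qed.

(** A negative [t] is handled on the segment [[t, 0]], where both sides change sign. Localising [c]
    by a norm bound lets the callers work in a ball without a case split. *)
Lemma MVT_line (R : realType) (V : normedModType R) (g : V -> R) (p v : V)
    (t : R) :
  (forall c : R, `|c| <= `|t| -> derivable g (p + c *: v) v) ->
  exists2 c : R, `|c| <= `|t| & g (p + t *: v) - g p = t * 'D_v g (p + c *: v).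
Proof.
move=> dg.
pose phi (r : R) := g (p + r *: v).
have dphi (c : R) : `|c| <= `|t| -> is_derive c 1 phi ('D_v g (p + c *: v)).
  by move=> ct; exact: (is_derive_lineP.1 (derivableP (dg c ct))).
have cphi (a b : R) : (forall c, c \in `[a, b] -> `|c| <= `|t|) ->
    {within `[a, b], continuous phi}.
  move=> abt; apply: derivable_within_continuous => c cab.
  by have [] := dphi c (abt _ cab).
case: (leP 0 t) => [t0|/ltW t0].
  have tE c : c \in `[0, t] -> `|c| <= `|t|.
    by rewrite in_itv/= => /andP[c0 ct]; rewrite !ger0_norm// (le_trans c0 ct).
  have [c cab] := @MVT_segment R phi _ _ _ t0
    (fun c cab => dphi c (tE _ (subset_itv_oo_cc cab))) (cphi _ _ tE).
  rewrite /phi scale0r addr0 subr0 mulrC => ->; exists c => //; exact: tE.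
have tE c : c \in `[t, 0] -> `|c| <= `|t|.
  by rewrite in_itv/= => /andP[ct c0]; rewrite !ler0_norm ?lerN2.
have [c cab] := @MVT_segment R phi _ _ _ t0
  (fun c cab => dphi c (tE _ (subset_itv_oo_cc cab))) (cphi _ _ tE).
rewrite /phi scale0r addr0 sub0r mulrN -opprB mulrC => /oppr_inj ->.
by exists c => //; exact: tE.
Qed.

Section Smooth.
Context {R : realType} {n : nat}.
Local Notation E := 'rV[R]_n.
Implicit Types (U : set E) (g h : E -> R).

Lemma norm_rV_le (v : E) (c : R) :
  0 <= c -> (forall i, `|v 0 i| <= c) -> `|v| <= c.
Proof.
move=> c0 vc; rewrite /Num.norm/= mx_normrE; apply/bigmax_leP.
by split => //= -[a b] _ /=; rewrite ord1.
Qed.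

Lemma norm_coord_le (v : E) (i : 'I_n) : `|v 0 i| <= `|v|.
Proof.
rewrite [leRHS]/Num.norm/= mx_normrE.
exact: (le_bigmax _ (fun ij => `|v ij.1 ij.2|) (0, i)).
Qed.

Lemma norm_scale_delta_le (c : R) (i : 'I_n) :
  `|c *: (delta_mx 0 i : E)| <= `|c|.
Proof.
apply: norm_rV_le => // j; rewrite !mxE eqxx/= normrM ler_piMr//.
by case: eqP; rewrite ?normr1 ?normr0.
Qed.

(** The increment from [x] to [x + v] is telescoped along a path that changes one coordinate at a
    time. On each leg the mean value theorem yields a partial derivative at a nearby point, and
    continuity compares it with the one at [x]. *)
Lemma differentiable_partials g (x : E) :
  (forall i, \forall y \near x, derivable g y (delta_mx 0 i)) ->
  (forall i, {for x, continuous (partial i g)}) ->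
  differentiable g x /\ forall v, 'd g x v = \sum_i v 0 i * partial i g x.
Proof.
move=> dg cg.
(* The vertices of the path, relative to [x]. *)
pose trunc (k : nat) (v : E) : E := \row_j (if (j < k)%N then v 0 j else 0).
pose L (v : E) : R := \sum_i v 0 i * partial i g x.
have Llin : linear L.
  move=> a u v; rewrite /L scaler_sumr -big_split/=; apply: eq_bigr => i _.
  by rewrite !mxE mulrDl -mulrA.
pose LL : {linear E -> R} := HB.pack L (GRing.isLinear.Build _ _ _ _ L Llin).
have cL : continuous LL.
  apply: (continuous_big add_continuous) => i _ v.
  apply: (@continuousM _ _ (fun u : E => u 0 i) (cst (partial i g x))).
    exact: coord_continuous.
  exact: cst_continuous.
(* The norm on [E] is the sup norm, so no point of the path is farther than [|v|] from its start. *)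
have ntrunc k (v : E) (j : 'I_n) (c : R) : j = k :> nat -> `|c| <= `|v 0 j| ->
    `|trunc k v + c *: delta_mx 0 j| <= `|v|.
  move=> jk cv; apply: norm_rV_le => // b; rewrite !mxE/=.
  have [->|nbj] := eqVneq b j.
    by rewrite jk ltnn add0r mulr1 (le_trans cv)// norm_coord_le.
  rewrite mulr0 addr0; case: ifP => _; first exact: norm_coord_le.
  by rewrite normr0.
have truncS k (v : E) (j : 'I_n) : j = k :> nat ->
    trunc k.+1 v = trunc k v + v 0 j *: delta_mx 0 j.
  move=> jk; apply/rowP => b; rewrite !mxE/= ltnS leq_eqVlt -jk.
  have [->|nbj] := eqVneq b j; first by rewrite eqxx ltnn mulr1 add0r.
  by rewrite mulr0 addr0 (_ : (b == j :> nat) = false)//; exact: negbTE.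
have gL : g \o shift x = cst (g x) + LL +o_ (0 : E) (id : E -> E).
  apply/eqaddoP => _/posnumP[e].
  (* Each of the [n] legs costs at most [e' * |v|]; the denominator [n + 1] also covers [n = 0]. *)
  pose e' := e%:num / n.+1%:R.
  have e'0 : 0 < e' by rewrite divr_gt0.
  have : \forall y \near x, forall i, derivable g y (delta_mx 0 i) /\
      `|partial i g x - partial i g y| < e'.
    apply: (@filter_forall E _ _ (nbhs x)) => i.
    apply: filterI; first exact: dg.
    by have /cvgrPdist_lt/(_ _ e'0) := cg i.
  move=> /nbhs_ballP[d /= d0 Hd].
  near=> v.
  have vd : `|v| < d by near: v; exact: (@nbhs0_lt R E).
  have Hd' (w : E) : `|w| <= `|v| -> forall i,
      derivable g (x + w) (delta_mx 0 i) /\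
      `|partial i g x - partial i g (x + w)| < e'.
    move=> wv; apply: Hd; rewrite -ball_normE/= opprD addrA subrr sub0r normrN.
    exact: le_lt_trans wv vd.
  have step (k : nat) : (k <= n)%N ->
    `|g (x + trunc k v) - g x - \sum_(i < n | (i < k)%N) v 0 i * partial i g x|
      <= k%:R * (e' * `|v|).
    elim: k => [_|k IH kn].
      rewrite big_pred0//. rewrite (_ : trunc 0%N v = 0).
        by rewrite addr0 subrr subr0 normr0 mul0r.
      by apply/rowP => j; rewrite !mxE.
    pose j := Ordinal kn.
    have [|c cv gc] := @MVT_line R _ g (x + trunc k v) (delta_mx 0 j) (v 0 j).
      by move=> c cv; rewrite -addrA; apply: (Hd' _ _ j).1; exact: ntrunc.
    rewrite (truncS k v j)// addrA (bigD1 j)//=.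
    rewrite (eq_bigl (fun i : 'I_n => (i < k)%N)); last first.
      move=> i; rewrite ltnS leq_eqVlt -(inj_eq val_inj)/=.
      by case: eqP => [->|]/=; rewrite ?ltnn ?andbT.
    rewrite (_ : _ - _ = v 0 j *
        ('D_(delta_mx 0 j) g (x + trunc k v + c *: delta_mx 0 j) -
         partial j g x) +
      (g (x + trunc k v) - g x -
       \sum_(i < n | (i < k)%N) v 0 i * partial i g x)); last first.
      by rewrite mulrBr -gc; ring.
    rewrite -natr1 mulrDl mul1r addrC (le_trans (ler_normD _ _))//.
    rewrite lerD ?(IH (ltnW kn))//.
    rewrite normrM mulrC ler_pM// ?norm_coord_le// distrC ltW//.
    by rewrite -addrA; apply: (Hd' _ _ j).2; exact: ntrunc.
  have := step n (leqnn n).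
  rewrite (_ : trunc n v = v); last by apply/rowP => j; rewrite mxE ltn_ord.
  rewrite (eq_bigl xpredT) => [|i]; last by rewrite ltn_ord.
  move=> /le_trans; rewrite !fctE/= opprD addrA (addrC v x); apply.
  rewrite mulrA ler_wpM2r// /e' mulrCA ler_piMr// ler_pdivrMr// mul1r ler_nat.
  exact: leqnSn.
have dE := diff_unique cL gL.
split; last by move=> v; rewrite dE.
by apply/diff_locallyP; rewrite dE.
Unshelve. all: by end_near. Qed.

(** * Smooth functions *)

Lemma near_open {U} {P : E -> Prop} {x : E} :
  open U -> U x -> (forall y, U y -> P y) -> \forall y \near x, P y.
Proof. by move=> oU Ux UP; apply: filterS UP _; exact: open_nbhs_nbhs. Qed.

Lemma eq_partial {U g h} i {x} : open U -> U x ->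
  (forall y, U y -> g y = h y) -> partial i g x = partial i h x.
Proof. by move=> oU Ux gh; apply: near_eq_derive; exact: near_open gh. Qed.

Lemma eq_iter_partial {U g h} s {x} : open U -> U x ->
  (forall y, U y -> g y = h y) -> iter_partial s g x = iter_partial s h x.
Proof.
move=> oU Ux gh; elim: s x Ux => [|i s IH] x Ux /=; first exact: gh.
exact: (eq_partial i oU Ux IH).
Qed.

Lemma smooth_continuous {U g x} : smooth U g -> U x -> {for x, continuous g}.
Proof. by move=> sg Ux; have [] := sg [::] x Ux. Qed.

Lemma smooth_derivable {U g x} i : smooth U g -> U x ->
  derivable g x (delta_mx 0 i).
Proof. by move=> sg Ux; have [] := sg [::] x Ux. Qed.

(** [iter_partial] is a [foldr], so the last entry of the list is the derivative taken first; hence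
    the [rcons]. *)
Lemma smooth_partial {U g} i : smooth U g -> smooth U (partial i g).
Proof.
move=> sg s x Ux; have := sg (rcons s i) x Ux.
by rewrite /iter_partial foldr_rcons.
Qed.

(* Induction over the order of differentiation: products and inverses are
   smooth because their partial derivatives are built from lower-order data. *)
Definition smooth_upto (k : nat) (U : set E) (g : E -> R) : Prop :=
  forall s : seq 'I_n, (size s <= k)%N -> forall x, U x ->
    {for x, continuous (iter_partial s g)} /\
    forall i, derivable (iter_partial s g) x (delta_mx 0 i).

Lemma smooth_uptoP {U g} : smooth U g <-> forall k, smooth_upto k U g.
Proof.
split=> [sg k s _ x|sg s x]; first exact: sg.
exact: (sg (size s)).
Qed.

Lemma smooth_uptoW {k U g} : smooth_upto k.+1 U g -> smooth_upto k U g.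
Proof. by move=> sg s sk; apply: sg; exact: leqW. Qed.

Lemma smooth_upto_partial {k U g} i :
  smooth_upto k.+1 U g -> smooth_upto k U (partial i g).
Proof.
move=> sg s sk x Ux; have := sg (rcons s i); rewrite size_rcons => /(_ sk x Ux).
by rewrite /iter_partial foldr_rcons.
Qed.

Lemma smooth_uptoS {k U g} : smooth_upto 0 U g ->
  (forall i, smooth_upto k U (partial i g)) -> smooth_upto k.+1 U g.
Proof.
move=> sg sdg s; case/lastP: s => [|s i]; first by move=> _; exact: sg.
rewrite size_rcons => sk x Ux; have := sdg i s sk x Ux.
by rewrite /iter_partial foldr_rcons.
Qed.

Lemma eq_smooth_upto {k U g h} : open U -> (forall y, U y -> g y = h y) ->
  smooth_upto k U g -> smooth_upto k U h.
Proof.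
move=> oU gh sg s sk x Ux; have [cg dg] := sg s sk x Ux.
have ghs : {near x, iter_partial s g =1 iter_partial s h}.
  by apply: (near_open oU Ux) => y Uy; exact: (eq_iter_partial s oU Uy gh).
split; last by move=> i; exact: near_eq_derivable ghs (dg i).
rewrite /prop_for /continuous_at -(nbhs_singleton ghs).
by apply: (cvg_trans _ cg); exact: (near_eq_cvg ghs).
Qed.

Lemma eq_smooth {U g h} : open U -> (forall y, U y -> g y = h y) ->
  smooth U g -> smooth U h.
Proof.
move=> oU gh /smooth_uptoP sg; apply/smooth_uptoP => k.
exact: (eq_smooth_upto oU gh (sg k)).
Qed.

Lemma smooth_upto0 {U g} : (forall x, U x -> {for x, continuous g} /\
  forall i, derivable g x (delta_mx 0 i)) -> smooth_upto 0 U g.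
Proof. by move=> gU s; rewrite leqn0 size_eq0 => /eqP ->; exact: gU. Qed.

Lemma smooth_upto_at {k U g x} : smooth_upto k U g -> U x ->
  {for x, continuous g} /\ forall i, derivable g x (delta_mx 0 i).
Proof. by move=> sg; exact: (sg [::]). Qed.

#[local] Opaque smooth smooth_upto.

Lemma smooth_uptoD {k U g h} : open U ->
  smooth_upto k U g -> smooth_upto k U h ->
  smooth_upto k U (fun x => g x + h x).
Proof.
move=> oU.
have base k' g' h' : smooth_upto k' U g' -> smooth_upto k' U h' ->
    smooth_upto 0 U (fun x => g' x + h' x).
  move=> sg sh; apply: smooth_upto0 => x Ux.
  have [cg dg] := smooth_upto_at sg Ux; have [ch dh] := smooth_upto_at sh Ux.
  by split=> [|i]; [exact: continuousD|exact: derivableD].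
elim: k g h => [|k IH] g h sg sh; first exact: base sg sh.
apply: smooth_uptoS; first exact: base sg sh.
move=> i; apply: eq_smooth_upto oU _
  (IH _ _ (smooth_upto_partial i sg) (smooth_upto_partial i sh)) => y Uy.
have [_ dg] := smooth_upto_at sg Uy; have [_ dh] := smooth_upto_at sh Uy.
by rewrite /partial deriveD.
Qed.

Lemma smooth_uptoM {k U g h} : open U ->
  smooth_upto k U g -> smooth_upto k U h ->
  smooth_upto k U (fun x => g x * h x).
Proof.
move=> oU.
have base k' g' h' : smooth_upto k' U g' -> smooth_upto k' U h' ->
    smooth_upto 0 U (fun x => g' x * h' x).
  move=> sg sh; apply: smooth_upto0 => x Ux.
  have [cg dg] := smooth_upto_at sg Ux; have [ch dh] := smooth_upto_at sh Ux.
  by split=> [|i]; [exact: continuousM|exact: derivableM].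
elim: k g h => [|k IH] g h sg sh; first exact: base sg sh.
apply: smooth_uptoS; first exact: base sg sh.
move=> i; apply: (@eq_smooth_upto _ _
  (fun x => g x * partial i h x + h x * partial i g x)) => // [y Uy|].
  have [_ dg] := smooth_upto_at sg Uy; have [_ dh] := smooth_upto_at sh Uy.
  by rewrite /partial deriveM.
by apply: smooth_uptoD => //; apply: IH;
  [exact: (smooth_uptoW sg)|exact: (smooth_upto_partial i sh)
  |exact: (smooth_uptoW sh)|exact: (smooth_upto_partial i sg)].
Qed.

Lemma smooth_cst {U} (c : R) : smooth U (fun=> c).
Proof.
apply/smooth_uptoP => k; elim: k c => [|k IH] c.
  apply: smooth_upto0 => x _; split; first exact: cst_continuous.
  by move=> i; exact: derivable_cst.
apply: smooth_uptoS => [|i].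
  apply: smooth_upto0 => x _; split; first exact: cst_continuous.
  by move=> i; exact: derivable_cst.
rewrite (_ : partial i _ = fun=> 0)//.
by apply/funext => x; exact: derive_cst.
Qed.

Lemma smoothD {U g h} : open U -> smooth U g -> smooth U h ->
  smooth U (fun x => g x + h x).
Proof.
move=> oU /smooth_uptoP sg /smooth_uptoP sh; apply/smooth_uptoP => k.
exact: smooth_uptoD.
Qed.

Lemma smoothM {U g h} : open U -> smooth U g -> smooth U h ->
  smooth U (fun x => g x * h x).
Proof.
move=> oU /smooth_uptoP sg /smooth_uptoP sh; apply/smooth_uptoP => k.
exact: smooth_uptoM.
Qed.

Lemma smoothN {U g} : open U -> smooth U g -> smooth U (fun x => - g x).
Proof.
move=> oU sg; have := smoothM oU (smooth_cst (-1)) sg.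
by apply: (eq_smooth oU) => y _; rewrite mulN1r.
Qed.

Lemma smoothB {U g h} : open U -> smooth U g -> smooth U h ->
  smooth U (fun x => g x - h x).
Proof. by move=> oU sg sh; exact: (smoothD oU sg (smoothN oU sh)). Qed.

Lemma smooth_sum {U} (I : finType) (G : I -> E -> R) : open U ->
  (forall i, smooth U (G i)) -> smooth U (fun x => \sum_i G i x).
Proof.
move=> oU sG; elim: (index_enum I) => [|i r IH].
  by rewrite (_ : (fun _ => _) = fun=> 0);
    [exact: smooth_cst|apply/funext => x; rewrite big_nil].
rewrite (_ : (fun _ => _) = fun x => G i x + \sum_(j <- r) G j x).
  exact: (smoothD oU (sG i) IH).
by apply/funext => x; rewrite big_cons.
Qed.

Lemma smoothV {U g} : open U -> smooth U g -> (forall x, U x -> g x != 0) ->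
  smooth U (fun x => (g x)^-1).
Proof.
move=> oU sg g0.
have base : smooth_upto 0 U (fun x => (g x)^-1).
  apply: smooth_upto0 => x Ux; split=> [|i].
    by apply: continuousV; [exact: g0|exact: (smooth_continuous sg Ux)].
  by apply: derivableV; [exact: g0|exact: (smooth_derivable _ sg Ux)].
apply/smooth_uptoP; elim=> [//|k IH].
apply: (smooth_uptoS base) => i; apply: (@eq_smooth_upto _ _
  (fun x => - partial i g x * ((g x)^-1 * (g x)^-1)) _ oU) => [y Uy|].
  rewrite /partial deriveV ?g0//; last exact: (smooth_derivable _ sg Uy).
  by rewrite /GRing.scale/= -exprVn expr2 mulNr mulNr mulrC.
apply: (smooth_uptoM oU _ (smooth_uptoM oU IH IH)).
by have /smooth_uptoP := smoothN oU (smooth_partial i sg); apply.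
Qed.

Lemma partialM {U g h x} i : smooth U g -> smooth U h -> U x ->
  partial i (fun y => g y * h y) x = g x * partial i h x + h x * partial i g x.
Proof.
by move=> sg sh Ux; rewrite /partial deriveM//; exact: smooth_derivable Ux.
Qed.

Lemma partial_cst (c : R) i (x : E) : partial i (fun=> c) x = 0.
Proof. exact: derive_cst. Qed.

Lemma partial_sum {U x} {m : nat} (G : 'I_m -> E -> R) i :
  (forall j, smooth U (G j)) -> U x ->
  partial i (fun y => \sum_j G j y) x = \sum_j partial i (G j) x.
Proof.
move=> sG Ux; rewrite /partial (_ : (fun _ => _) = \sum_j G j).
  by rewrite derive_sum// => j; exact: (smooth_derivable i (sG j) Ux).
by apply/funext => y; rewrite fct_sumE.
Qed.

Lemma smooth_differentiable {U g x} : open U -> smooth U g -> U x ->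
  differentiable g x /\ forall v, 'd g x v = \sum_i v 0 i * partial i g x.
Proof.
move=> oU sg Ux; apply: differentiable_partials => i.
  by apply: (near_open oU Ux) => y; exact: smooth_derivable.
exact: (smooth_continuous (smooth_partial i sg) Ux).
Qed.

(** Derivatives of order at least one are inherited from the [G i]. The continuity of [g] itself
    does not follow from the mere existence of partials; it comes from total differentiability,
    available because the partials are continuous. *)
Lemma smooth_of_partials {U g} {G : 'I_n -> E -> R} : open U ->
  (forall i x, U x -> is_derive x (delta_mx 0 i) g (G i x)) ->
  (forall i, smooth U (G i)) -> smooth U g.
Proof.
move=> oU gG sG.
have sdg i : smooth U (partial i g).
  apply: (eq_smooth oU _ (sG i)) => y Uy.
  by rewrite /partial (@derive_val _ _ _ _ _ _ _ (gG i y Uy)).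
have dg i y : U y -> derivable g y (delta_mx 0 i) by move=> /(gG i)[].
move=> s x Ux; case/lastP: s => [|s i].
  split; last by move=> i; exact: dg.
  apply: differentiable_continuous.
  have [] := @differentiable_partials g x => // i.
    by apply: (near_open oU Ux) => y; exact: dg.
  exact: (smooth_continuous (sdg i) Ux).
by have := sdg i s x Ux; rewrite /iter_partial foldr_rcons.
Qed.

Lemma is_derive_smooth {U g x} (v : E) : open U -> smooth U g -> U x ->
  is_derive x v g (\sum_i v 0 i * partial i g x).
Proof.
move=> oU sg Ux; have [dg dgE] := smooth_differentiable oU sg Ux.
by apply: DeriveDef; [exact: diff_derivable|rewrite deriveE// dgE].
Qed.

(* The left-hand side is symmetric in [i] and [j]; as [h] tends to 0 this forces
   the mixed derivatives to agree. *)
Lemma second_difference {U g x} (i j : 'I_n) (h : R) : smooth U g ->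
  (forall y, `|y - x| <= `|h| + `|h| -> U y) ->
  exists2 y, `|y - x| <= `|h| + `|h| &
    g (x + h *: delta_mx 0 j + h *: delta_mx 0 i) - g (x + h *: delta_mx 0 i)
      - (g (x + h *: delta_mx 0 j) - g x) = h * (h * partial j (partial i g) y).
Proof.
move=> sg xU.
have near_x (b c : R) : `|b| <= `|h| -> `|c| <= `|h| ->
    `|x + b *: delta_mx 0 j + c *: delta_mx 0 i - x| <= `|h| + `|h|.
  move=> bh ch; rewrite -(addrA x) [x + _]addrC addrK.
  rewrite (le_trans (ler_normD _ _))// lerD //;
    exact: le_trans (norm_scale_delta_le _ _) _.
have near_x0 (c : R) : `|c| <= `|h| ->
    `|x + c *: delta_mx 0 i - x| <= `|h| + `|h|.
  by move=> ch; have := near_x 0 c; rewrite normr0 scale0r addr0; exact.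
(* The mean value theorem is applied twice: along direction [i] to this increment in direction [j],
   then along direction [j] to [partial i g]. *)
pose G y := g (h *: delta_mx 0 j + y) - g y.
have dG (c : R) : `|c| <= `|h| ->
    is_derive (x + c *: delta_mx 0 i) (delta_mx 0 i) G
      (partial i g (h *: delta_mx 0 j + (x + c *: delta_mx 0 i)) -
       partial i g (x + c *: delta_mx 0 i)).
  move=> ch; apply: is_deriveB; first apply: is_derive_translate.
    apply/derivableP/(smooth_derivable _ sg)/xU.
    by rewrite addrA [_ + x]addrC; exact: near_x.
  by apply/derivableP/(smooth_derivable _ sg)/xU; exact: near_x0.
have [|c ch] := @MVT_line R _ G x (delta_mx 0 i) h.
  by move=> c /dG[].
rewrite (@derive_val _ _ _ _ _ _ _ (dG c ch)) /G.
have [|b bh] := @MVT_line R _ (partial i g) (x + c *: delta_mx 0 i)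
  (delta_mx 0 j) h.
  move=> b bh; apply: (@smooth_derivable U); first exact: smooth_partial.
  by apply: xU; rewrite (addrAC x); exact: near_x.
rewrite [_ + (x + c *: _)]addrC => ->.
rewrite [_ + (x + h *: _)]addrC [_ + x]addrC (addrAC x).
move=> E; exists (x + c *: delta_mx 0 i + b *: delta_mx 0 j).
  by rewrite (addrAC x); exact: near_x.
by rewrite -E; ring.
Qed.

End Smooth.

#[local] Opaque smooth.

(** * Schwarz and Cartan formulas *)

Lemma ler_dist_half {R : realFieldType} {u v p e : R} :
  `|u - p| < e / 2 -> `|v - p| < e / 2 -> `|u - v| <= e.
Proof.
move=> up vp; rewrite -(subrKA p) (le_trans (ler_normD _ _))//.
by rewrite [e]splitr lerD ?ltW// distrC.
Qed.

(** Here [a] and [d] are the values at opposite corners of a square; exchanging the two directions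
    swaps [b] and [c] and leaves the alternating sum unchanged. *)
Lemma second_difference_cancel {R : fieldType} {h a b c d p q : R} : h != 0 ->
  a - b - (c - d) = h * (h * p) -> a - c - (b - d) = h * (h * q) -> p = q.
Proof.
move=> h0 Ep Eq; apply: (mulfI h0); apply: (mulfI h0); rewrite -Ep -Eq; ring.
Qed.

(** The letters [a] to [f] stand for the partials of the components of the form, and [gi], [gj],
    [gk] for those of [g]. The latter cancel in the cyclic sum, leaving [g * g] times the
    hypothesis. *)
Lemma wedge_scale {R : comPzRingType} {g gi gj gk wi wj wk a b c d e f : R} :
  (a - b) * wk + (c - d) * wi + (e - f) * wj = 0 ->
  (g * a + wj * gi - (g * b + wi * gj)) * (g * wk) +
  (g * c + wk * gj - (g * d + wj * gk)) * (g * wi) +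
  (g * e + wi * gk - (g * f + wk * gi)) * (g * wj) = 0.
Proof. by move=> w0; rewrite -[RHS](mulr0 (g * g)) -w0; ring. Qed.

Section Forms.
Context {R : realType} {n : nat}.
Local Notation E := 'rV[R]_n.
Implicit Types (U : set E) (g h : E -> R) (w : form1 R n) (A B : vfield R n).

Lemma partialC {U g x} (i j : 'I_n) : open U -> smooth U g -> U x ->
  partial i (partial j g) x = partial j (partial i g) x.
Proof.
move=> oU sg Ux; apply/eqP; rewrite -subr_eq0 -normr_le0.
apply/ler_addgt0Pr => e e0; rewrite add0r.
have e20 : 0 < e / 2 by rewrite divr_gt0.
have cont k l : {for x, continuous (partial k (partial l g))}.
  exact: (smooth_continuous (smooth_partial k (smooth_partial l sg)) Ux).
have /cvgrPdist_lt/(_ _ e20) cij := cont i j.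
have /cvgrPdist_lt/(_ _ e20) cji := cont j i.
have : \forall y \near x, U y /\
    (`|partial i (partial j g) x - partial i (partial j g) y| < e / 2 /\
     `|partial j (partial i g) x - partial j (partial i g) y| < e / 2).
  exact: (filterI (open_nbhs_nbhs (conj oU Ux)) (filterI cij cji)).
move=> /nbhs_ballP[d /= d0 Hd].
(* Both intermediate points are within [2 h] of [x], and [2 h < d]. *)
pose h := d / 3.
have h0 : 0 < h by rewrite divr_gt0.
have Hd' y : `|y - x| <= `|h| + `|h| -> ball x d y.
  rewrite gtr0_norm// -ball_normE/= distrC => /le_lt_trans; apply.
  by rewrite /h; lra.
have hU y : `|y - x| <= `|h| + `|h| -> U y by move=> /Hd'/Hd[].
have [y /Hd'/Hd[_ [_ yi]]] := second_difference i j h sg hU.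
have [z /Hd'/Hd[_ [zi _]]] := second_difference j i h sg hU.
rewrite (addrAC x) => Ez Ey.
have Eyz := second_difference_cancel (lt0r_neq0 h0) Ey Ez.
by rewrite Eyz in yi; exact: (ler_dist_half zi yi).
Qed.

Lemma vf_apply_smooth {U g A} : open U -> smooth U g ->
  smooth_vfield U A -> smooth U (vf_apply A g).
Proof.
move=> oU sg sA; apply: (smooth_sum _ _ oU) => i.
exact: (smoothM oU (sA i) (smooth_partial i sg)).
Qed.

Lemma lie_bracket_smooth {U A B} : open U -> smooth_vfield U A ->
  smooth_vfield U B -> smooth_vfield U (lie_bracket A B).
Proof.
move=> oU sA sB i.
rewrite (_ : (fun _ => _) = fun x => vf_apply A (fun y => B y 0 i) x -
    vf_apply B (fun y => A y 0 i) x); last by apply/funext => x; rewrite mxE.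
exact: (smoothB oU (vf_apply_smooth oU (sB i) sA)
  (vf_apply_smooth oU (sA i) sB)).
Qed.

Lemma vf_scale_smooth {U g A} : open U -> smooth U g -> smooth_vfield U A ->
  smooth_vfield U (vf_scale g A).
Proof.
move=> oU sg sA i; rewrite (_ : (fun _ => _) = fun x => g x * A x 0 i).
  exact: (smoothM oU sg (sA i)).
by apply/funext => x; rewrite mxE.
Qed.

Lemma vf_apply_cst {U g A x} (c : R) : open U -> U x ->
  (forall y, U y -> g y = c) -> vf_apply A g x = 0.
Proof.
move=> oU Ux gc; rewrite /vf_apply big1// => i _.
by rewrite (eq_partial i oU Ux gc) partial_cst mulr0.
Qed.

Lemma vf_apply_interior_product {U w A B x} : open U -> smooth_form1 U w ->
  smooth_vfield U B -> U x ->
  vf_apply A (interior_product B w) x =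
  \sum_i \sum_j (A x 0 i * B x 0 j * partial i (fun y => w y j 0) x +
                 A x 0 i * w x j 0 * partial i (fun y => B y 0 j) x).
Proof.
move=> oU sw sB Ux; apply: eq_bigr => i _.
rewrite (partial_sum _ i (fun j => smoothM oU (sB j) (sw j)) Ux).
rewrite mulr_sumr; apply: eq_bigr => j _.
by rewrite (partialM i (sB j) (sw j) Ux); ring.
Qed.

(** By the Leibniz rule, the first two terms on the right split into derivatives of [w] and
    derivatives of the fields; the bracket term cancels exactly the latter. *)
Lemma d1_cartan {U w A B x} : open U -> smooth_form1 U w -> smooth_vfield U A ->
  smooth_vfield U B -> U x ->
  \sum_i \sum_j A x 0 i * B x 0 j * d1 w x i j =
  vf_apply A (interior_product B w) x - vf_apply B (interior_product A w) x
    - interior_product (lie_bracket A B) w x.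
Proof.
move=> oU sw sA sB Ux.
rewrite (vf_apply_interior_product oU sw sB Ux).
rewrite (vf_apply_interior_product oU sw sA Ux).
have -> : interior_product (lie_bracket A B) w x = \sum_i \sum_j
    (A x 0 i * w x j 0 * partial i (fun y => B y 0 j) x
     - B x 0 i * w x j 0 * partial i (fun y => A y 0 j) x).
  rewrite exchange_big; apply: eq_bigr => j _.
  rewrite mxE /vf_apply -sumrB mulr_suml; apply: eq_bigr => i _.
  by ring.
have -> : \sum_i \sum_j A x 0 i * B x 0 j * d1 w x i j =
    (\sum_i \sum_j A x 0 i * B x 0 j * partial i (fun y => w y j 0) x)
    - \sum_i \sum_j B x 0 i * A x 0 j * partial i (fun y => w y j 0) x.
  rewrite [X in _ - X]exchange_big -sumrB; apply: eq_bigr => i _.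
  by rewrite -sumrB; apply: eq_bigr => j _; rewrite mxE; ring.
rewrite -!sumrB; apply: eq_bigr => i _.
by rewrite -!sumrB; apply: eq_bigr => j _; ring.
Qed.

(* d(g w) = dg /\ w + g dw, and both wedge products with w vanish. *)
Lemma frobenius_scale {U g w} : smooth U g -> smooth_form1 U w ->
  frobenius_integrable U w ->
  frobenius_integrable U (fun x => g x *: w x).
Proof.
move=> sg sw fw x Ux i j k.
have pE a b : partial a (fun y => (g y *: w y) b 0) x =
    g x * partial a (fun y => w y b 0) x + w x b 0 * partial a g x.
  rewrite -(partialM a sg (sw b) Ux); congr (partial a _ x).
  by apply/funext => y; rewrite mxE.
have := fw x Ux i j k; rewrite /wedge21 !mxE !pE => fwx.
exact: wedge_scale fwx.
Qed.

Lemma d1_d0 {U w g} : open U -> smooth U g ->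
  (forall x, U x -> w x = d0 g x) -> forall x, U x -> d1 w x = 0.
Proof.
move=> oU sg wg x Ux; apply/matrixP => i j; rewrite !mxE.
have E a : forall y, U y -> w y a 0 = partial a g y.
  by move=> y Uy; rewrite wg// mxE.
rewrite (eq_partial i oU Ux (E j)) (eq_partial j oU Ux (E i)).
by rewrite (partialC i j oU sg Ux) subrr.
Qed.

End Forms.

(** * Poincare lemma *)

Section Leibniz.
Context {R : realType}.
Local Notation mu := (@lebesgue_measure R).
Implicit Types (f df : R -> R -> R).

Lemma continuous_slice {f} {s t : R} :
  {for (s, t), continuous (fun z : R * R => f z.1 z.2)} ->
  {for t, continuous (f s)}.
Proof.
by move=> cf; exact: (cvg_comp2 (cvg_cst s) cvg_id cf).
Qed.

Lemma integrable_segment (g : R -> R) (a b : R) :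
  (forall t : R, a <= t <= b -> {for t, continuous g}) ->
  mu.-integrable `[a, b] (EFin \o g).
Proof.
move=> cg; apply: continuous_compact_integrable; first exact: segment_compact.
by apply: continuous_in_subspaceT => t; rewrite inE/= in_itv/=; exact: cg.
Qed.

(** Differentiating under the integral requires an integrable bound on the derivative that is
    uniform in [s]. A constant serves: the maximum of [|df|] on the compact rectangle [[-d, d] x
    [0, 1]]. *)
Lemma is_derive_integral {f df} {d : R} : 0 < d ->
  (forall s t : R, `|s| <= d -> 0 <= t <= 1 ->
    is_derive s 1 (f ^~ t) (df s t)) ->
  (forall s t : R, `|s| <= d -> 0 <= t <= 1 ->
    {for (s, t), continuous (fun z : R * R => f z.1 z.2)}) ->
  (forall s t : R, `|s| <= d -> 0 <= t <= 1 ->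
    {for (s, t), continuous (fun z : R * R => df z.1 z.2)}) ->
  is_derive (0 : R) 1 (fun s : R => \int[mu]_(t in `[0, 1]) f s t)
    (\int[mu]_(t in `[0, 1]) df 0 t).
Proof.
move=> d0 fdf cf cdf.
pose K : set (R * R) := `[- d, d] `*` `[0, 1].
have KE s t : (s, t) \in K = (`|s| <= d) && (0 <= t <= 1).
  rewrite ler_norml; apply/idP/idP.
    by rewrite inE/= /K => -[]/=; rewrite !in_itv/= => -> ->.
  by move=> /andP[? ?]; rewrite inE; split; rewrite /= in_itv.
have cK : compact K by apply: compact_setX; exact: segment_compact.
have K0 : K !=set0.
  exists (0, 0); have : (0, 0) \in K by rewrite KE normr0 ltW//= lexx ler01.
  by rewrite inE.
have [[s1 t1] _ dfM] : exists2 c, c \in K &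
    forall z, z \in K -> `|df z.1 z.2| <= `|df c.1 c.2|.
  apply: (@compact_EVT_max _ _ (fun z : R * R => `|df z.1 z.2|)) => //.
  apply: continuous_in_subspaceT => -[s t]; rewrite KE => /andP[sd t01].
  apply: (@continuous_comp _ _ _ (fun z : R * R => df z.1 z.2) Num.norm).
    exact: cdf.
  exact: norm_continuous.
pose M := `|df s1 t1|.
have Id s : `]- d, d[%classic s -> `|s| <= d.
  by rewrite /= in_itv/= => /andP[/ltW sd /ltW ds]; rewrite ler_norml sd ds.
have I0 : `]- d, d[%classic (0 : R) by rewrite /= in_itv/= oppr_lt0 d0.
have m01 : measurable (`[0, 1] : set R) by exact: measurable_itv.
have T01 t : `[0, 1]%classic t -> 0 <= t <= 1 by rewrite /= in_itv.
have intf s : `]- d, d[%classic s -> mu.-integrable `[0, 1] (EFin \o f s).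
  move=> /Id sd; apply: integrable_segment => t t01.
  exact: continuous_slice (cf _ _ sd t01).
have derf s t : `]- d, d[%classic s -> `[0, 1]%classic t ->
    derivable (f ^~ t) s 1.
  by move=> /Id sd /T01 t01; have [] := fdf s t sd t01.
have intM : mu.-integrable `[0, 1] (EFin \o (fun _ : R => M)).
  by apply: integrable_segment => t _; exact: cst_continuous.
have dfE s t : `]- d, d[%classic s -> `[0, 1]%classic t ->
    partial1of2 f s t = df s t.
  move=> /Id sd /T01 t01; rewrite partial1of2E.
  exact: (@derive_val _ _ _ _ _ _ _ (fdf s t sd t01)).
have df_ub s t : `]- d, d[%classic s -> `[0, 1]%classic t ->
    `|partial1of2 f s t| <= M.
  move=> ds t01; rewrite dfE//; apply: (dfM (s, t)).
  by rewrite KE Id//=; exact: T01.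
have M0 (t : R) : 0 <= M by exact: normr_ge0.
apply: DeriveDef.
  exact: (@derivable_under_integral _ _ _ mu f _ m01 0 (- d) d I0 intf derf
    (fun=> M) M0 intM df_ub).
rewrite -derive1E (@differentiation_under_integral _ _ _ mu f _ m01 0 (- d) d I0
  intf derf (fun=> M) M0 intM df_ub).
by apply: eq_Rintegral => t; rewrite inE => t01; rewrite dfE.
Qed.

Lemma Rintegral_derive {F g : R -> R} :
  (forall t : R, 0 <= t <= 1 -> is_derive t 1 F (g t)) ->
  (forall t : R, 0 <= t <= 1 -> {for t, continuous g}) ->
  \int[mu]_(t in `[0, 1]) g t = F 1 - F 0.
Proof.
move=> Fg cg.
have cF t : 0 <= t <= 1 -> {for t, continuous F}.
  move=> /Fg[dF _]; apply: differentiable_continuous.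
  exact/derivable1_diffP.
rewrite /Rintegral (@continuous_FTC2 R g F)//.
- apply: continuous_in_subspaceT => t; rewrite inE/= in_itv/=; exact: cg.
- split.
  + by move=> t; rewrite in_itv/= => /andP[/ltW t0 /ltW t1];
      have [|] := Fg t; rewrite ?t0.
  + by apply: cvg_at_right_filter; apply: cF; rewrite lexx ler01.
  + by apply: cvg_at_left_filter; apply: cF; rewrite lexx ler01.
- move=> t; rewrite in_itv/= => /andP[/ltW t0 /ltW t1].
  by rewrite derive1E (@derive_val _ _ _ _ _ _ _ (Fg t _)) ?t0.
Qed.

End Leibniz.

Lemma is_derive_affine {R : realType} (a b s : R) :
  is_derive s 1 (fun r : R => a + r * b) b.
Proof.
have := is_deriveD (is_derive_cst a s (1 : R))
  (is_deriveZ b (is_derive_id s (1 : R))).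
rewrite add0r [b *: 1]mulr1 (_ : cst a + _ = (fun r : R => a + r * b))//.
by apply/funext => r; rewrite !fctE mulrC.
Qed.

Section Poincare.
Context {R : realType} {n : nat}.
Local Notation E := 'rV[R]_n.
Local Notation mu := (@lebesgue_measure R).

(** The primitive [F x] is the integral of [w] along the segment from the centre [x0] to [x].
    Closedness makes the i-th partial of the integrand equal to the [t]-derivative of
    [t * w_i (x0 + t (x - x0))], which integrates to [w_i x]. *)
Lemma poincare {U : set E} {w : form1 R n} : open U -> star_shaped U ->
  smooth_form1 U w -> (forall x, U x -> d1 w x = 0) -> exact_form1 U w.
Proof.
move=> oU [x0 Ux0 star] sw dw.
have wC i j x : U x ->
    partial i (fun y => w y j 0) x = partial j (fun y => w y i 0) x.
  move=> /dw/matrixP/(_ i j); rewrite !mxE; exact: subr0_eq.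
pose H (x : E) (t : R) : R := \sum_j (x - x0) 0 j * w (x0 + t *: (x - x0)) j 0.
pose F (x : E) : R := \int[mu]_(t in `[0, 1]) H x t.
have dF i x : U x -> is_derive x (delta_mx 0 i) F (w x i 0).
  move=> Ux; pose e : E := delta_mx 0 i.
  have [d d0 Ud] : exists2 d : R, 0 < d &
      forall s : R, `|s| <= d -> U (x + s *: e).
    have /nbhs_ballP[r /= r0 rU] : nbhs x U by exact: open_nbhs_nbhs.
    (* The range [|s| <= d] has to be closed for the compactness argument, hence half the radius of
       the ball. *)
    exists (r / 2) => [|s sr]; first by rewrite divr_gt0.
    apply: rU; rewrite -ball_normE/= opprD addrA subrr sub0r normrN.
    rewrite (le_lt_trans (norm_scale_delta_le _ _))// (le_lt_trans sr)//.
    by rewrite ltr_pdivrMr// ltr_pMr// ltr1n.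
  (* The segment from [x0] whose endpoint is displaced by [s] in direction [e]. For fixed [t] it is
     a line in [s] with velocity [t e], which explains the factor [t] in [df]. *)
  pose ga (z : R * R) : E := x0 + z.2 *: (x + z.1 *: e - x0).
  have Uga (s t : R) : `|s| <= d -> 0 <= t <= 1 -> U (ga (s, t)).
    by move=> sd t01; apply: star => //; exact: Ud.
  have cy : continuous (fun z : R * R => x + z.1 *: e - x0).
    move=> z; apply: cvgB; last exact: cvg_cst.
    apply: cvgD; first exact: cvg_cst.
    by apply: cvgZr_tmp; exact: cvg_fst.
  have cga : continuous ga.
    move=> z; apply: cvgD; first exact: cvg_cst.
    by apply: cvgZ; [exact: cvg_snd|exact: cy].
  have cyj (j : 'I_n) : continuous (fun z : R * R => (x + z.1 *: e - x0) 0 j).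
    move=> z; apply: (@continuous_comp _ _ _
      (fun z : R * R => x + z.1 *: e - x0) (fun v : E => v 0 j) z).
      exact: cy.
    exact: coord_continuous.
  have cUga (g : E -> R) (s t : R) : smooth U g -> `|s| <= d -> 0 <= t <= 1 ->
      {for (s, t), continuous (fun z => g (ga z))}.
    move=> sg sd t01; apply: (@continuous_comp _ _ _ ga g (s, t)).
      exact: cga.
    exact: (smooth_continuous sg (Uga s t sd t01)).
  pose df (s t : R) := w (ga (s, t)) i 0 +
    t * \sum_j (x + s *: e - x0) 0 j * partial i (fun y => w y j 0) (ga (s, t)).
  have cdf (s t : R) : `|s| <= d -> 0 <= t <= 1 ->
      {for (s, t), continuous (fun z : R * R => df z.1 z.2)}.
    move=> sd t01; apply: cvgD; first exact: (cUga _ _ _ (sw i)).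
    apply: cvgM; first exact: cvg_snd.
    apply: (cvg_big add_continuous) => j _; apply: cvgM; first exact: cyj.
    exact: (cUga _ _ _ (smooth_partial i (sw j))).
  have cH (s t : R) : `|s| <= d -> 0 <= t <= 1 ->
      {for (s, t), continuous (fun z : R * R => H (x + z.1 *: e) z.2)}.
    move=> sd t01; apply: (cvg_big add_continuous) => j _.
    by apply: cvgM; [exact: cyj|exact: (cUga _ _ _ (sw j))].
  have dH (s t : R) : `|s| <= d -> 0 <= t <= 1 ->
      is_derive s 1 (fun r : R => H (x + r *: e) t) (df s t).
    move=> sd t01.
    have dy j : is_derive s 1 (fun r : R => (x + r *: e - x0) 0 j) (e 0 j).
      rewrite (_ : (fun _ => _) = fun r : R => (x - x0) 0 j + r * e 0 j).
        exact: is_derive_affine.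
      by apply/funext => r; rewrite !mxE addrAC.
    have dwj j : is_derive s 1
        (fun r : R => w (x0 + t *: (x + r *: e - x0)) j 0)
        (t * partial i (fun y => w y j 0) (ga (s, t))).
      have gaE (r : R) : x0 + t *: (x + r *: e - x0) =
          (x0 + t *: (x - x0)) + r *: (t *: e).
        by rewrite addrAC scalerDr addrA !scalerA mulrC.
      have -> : t * partial i (fun y => w y j 0) (ga (s, t)) =
          \sum_k (t *: e) 0 k * partial k (fun y => w y j 0) (ga (s, t)).
        rewrite (bigD1 i)//= big1 ?addr0 => [|k ki].
          by rewrite !mxE !eqxx mulr1.
        by rewrite !mxE (negbTE ki) andbF mulr0 mul0r.
      under eq_fun do rewrite gaE.
      apply: (is_derive_lineP (g := fun y => w y j 0)).1; rewrite -gaE.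
      exact: (is_derive_smooth _ oU (sw j) (Uga s t sd t01)).
    have -> : df s t = \sum_j ((x + s *: e - x0) 0 j *:
        (t * partial i (fun y => w y j 0) (ga (s, t))) +
        w (ga (s, t)) j 0 *: e 0 j).
      rewrite big_split/= addrC; congr (_ + _).
        rewrite (bigD1 i)//= big1 ?addr0 => [|k ki].
          by rewrite /e mxE !eqxx; exact/esym/mulr1.
        by rewrite /e mxE (negbTE ki) andbF; exact: mulr0.
      by rewrite mulr_sumr; apply: eq_bigr => j _; exact: mulrCA.
    rewrite (_ : (fun _ => _) = \sum_j (fun r : R => (x + r *: e - x0) 0 j *
        w (x0 + t *: (x + r *: e - x0)) j 0)).
      by apply: is_derive_sum => j; exact: is_deriveM (dy j) (dwj j).
    by apply/funext => r; rewrite fct_sumE.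
  have dFl := is_derive_integral (f := fun s t => H (x + s *: e) t) d0
    dH cH cdf.
  have <- : \int[mu]_(t in `[0, 1]) df 0 t = w x i 0.
    have d00 : `|0 : R| <= d by rewrite normr0 ltW.
    (* Closedness is used here, through [wC]: it exchanges the two indices in the sum, so that
       [df 0 t] becomes a total derivative in [t]. *)
    have dtw (t : R) : 0 <= t <= 1 ->
        is_derive t 1 (fun r : R => r * w (ga (0, r)) i 0) (df 0 t).
      move=> t01; have -> : df 0 t = t *: (\sum_j (x + 0 *: e - x0) 0 j *
          partial j (fun y => w y i 0) (ga (0, t))) + w (ga (0, t)) i 0 *: 1.
        rewrite addrC; congr (_ + _); first exact/esym/mulr1.
        congr (t * _); apply: eq_bigr => j _; congr (_ * _).
        exact: (wC _ _ _ (Uga 0 t d00 t01)).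
      have Ut : U (x0 + t *: (x + 0 *: e - x0)) := Uga 0 t d00 t01.
      exact: (is_deriveM (is_derive_id t (1 : R))
        (is_derive_lineP.1 (is_derive_smooth _ oU (sw i) Ut))).
    rewrite (Rintegral_derive dtw) => [|t t01].
      by rewrite mul1r mul0r subr0 /ga/= scale1r scale0r addr0 addrC subrK.
    exact: continuous_slice (cdf 0 t d00 t01).
  rewrite -[x in is_derive x](_ : x + 0 *: e = x).
    exact: (is_derive_lineP.2 dFl).
  by rewrite scale0r addr0.
exists F; first exact: (smooth_of_partials oU dF sw).
move=> x Ux; apply/colP => i; rewrite mxE.
by rewrite /partial (@derive_val _ _ _ _ _ _ _ (dF i x Ux)).
Qed.

End Poincare.

(** * Distributions and symmetries *)

(* Contracting the hypothesis [D /\ u = 0] with [v], where [u v = 1], gives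
   [D = u /\ (v D)]. *)
Lemma two_form_eq0 {R : comPzRingType} {n : nat} {D : 'M[R]_n} {u : 'cV[R]_n}
    {v : 'rV[R]_n} :
  (forall i j, D i j = - D j i) ->
  (forall i j k, D i j * u k 0 + D j k * u i 0 + D k i * u j 0 = 0) ->
  \sum_i v 0 i * u i 0 = 1 -> v *m D = 0 -> D = 0.
Proof.
move=> Dalt Du vu vD; apply/matrixP => j k; rewrite mxE.
have vD0 l : \sum_i v 0 i * D i l = 0.
  by have /rowP/(_ l) := vD; rewrite !mxE.
have : \sum_i v 0 i * (D i j * u k 0 + D j k * u i 0 + D k i * u j 0) = 0.
  by rewrite big1// => i _; rewrite Du mulr0.
rewrite (eq_bigr (fun i => v 0 i * D i j * u k 0 + v 0 i * u i 0 * D j k -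
  v 0 i * D i k * u j 0)) => [|i _]; last by rewrite (Dalt k i); ring.
rewrite sumrB big_split/= -!mulr_suml vu !vD0 => <-; ring.
Qed.

Section Distributions.
Context {R : realType} {n : nat}.
Local Notation E := 'rV[R]_n.
Implicit Types (U : set E) (w : form1 R n) (A X Y : vfield R n).

Lemma span_vf_frame {U} {r : nat} (B : 'I_r -> vfield R n) k :
  span_vf U B (B k).
Proof.
exists (fun i _ => (i == k)%:R) => [i|x _]; first exact: smooth_cst.
rewrite (bigD1 k)//= eqxx scale1r big1 ?addr0// => i ik.
by rewrite (negbTE ik) scale0r.
Qed.

Lemma span_vf_scale {U} {r : nat} {B : 'I_r -> vfield R n}
    {g : 'I_r -> E -> R} : open U -> (forall i, smooth U (g i)) ->
  (forall i x, U x -> g i x != 0) ->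
  span_vf U (fun i => vf_scale (g i) (B i)) = span_vf U B.
Proof.
move=> oU sg g0; apply/seteqP; split=> Y [a sa Ya].
  exists (fun i x => a i x * g i x) => [i|x Ux].
    exact: (smoothM oU (sa i) (sg i)).
  by rewrite Ya//; apply: eq_bigr => i _; rewrite scalerA.
exists (fun i x => a i x * (g i x)^-1) => [i|x Ux].
  exact: (smoothM oU (sa i) (smoothV oU (sg i) (g0 i))).
rewrite Ya//; apply: eq_bigr => i _.
by rewrite /vf_scale scalerA -mulrA mulVf ?mulr1//; exact: g0.
Qed.

Lemma independent_on_scale {U} {r : nat} {B : 'I_r -> vfield R n}
    {g : 'I_r -> E -> R} : (forall i x, U x -> g i x != 0) ->
  independent_on U B -> independent_on U (fun i => vf_scale (g i) (B i)).
Proof.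
move=> g0 iB x Ux; have := iB x Ux.
pose P : 'M[R]_r := diag_mx (\row_i g i x).
rewrite (_ : \matrix_i vf_scale (g i) (B i) x = P *m \matrix_i B i x).
  rewrite /row_free (eqmxMfull (\matrix_i B i x) (_ : row_full P))//.
  rewrite row_full_unit unitmxE det_diag unitfE prodf_seq_neq0.
  by apply/allP => i _ /=; rewrite mxE g0.
by apply/matrixP => i j; rewrite mul_diag_mx !mxE.
Qed.

Lemma interior_product_scaler g w A x :
  interior_product A (fun y => g y *: w y) x = g x * interior_product A w x.
Proof.
by rewrite mulr_sumr; apply: eq_bigr => i _; rewrite mxE mulrCA.
Qed.

Lemma interior_product_scalel g w A x :
  interior_product (vf_scale g A) w x = g x * interior_product A w x.
Proof. by rewrite mulr_sumr; apply: eq_bigr => i _; rewrite mxE mulrA. Qed.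

Lemma interior_product_comb {r : nat} {B : 'I_r -> vfield R n} {c : 'I_r -> R}
    w A x : A x = \sum_k c k *: B k x ->
  interior_product A w x = \sum_k c k * interior_product (B k) w x.
Proof.
move=> Ax; under [RHS]eq_bigr do rewrite mulr_sumr.
rewrite exchange_big/=; apply: eq_bigr => i _.
rewrite Ax summxE mulr_suml; apply: eq_bigr => k _.
by rewrite mxE mulrA.
Qed.

(** Inserting the factor [1] on the fields of [Z] makes the change from [X] to [f X] a rescaling of
    the whole frame, to which the two preceding rescaling lemmas on spans and independence apply. *)
Lemma extend_scale {r : nat} (Z : 'I_r -> vfield R n) X (f : E -> R) :
  extend Z (vf_scale f X) = fun i => vf_scale
    (if fintype.split i is inl _ then fun=> 1 else f) (extend Z X i).
Proof.
apply/funext => i; rewrite /extend; case: fintype.split => // k.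
by apply/funext => x; rewrite /vf_scale scale1r.
Qed.

(** A non-vanishing smooth factor is invertible among smooth functions, so the extended frame
    generates the same module and involutivity carries over. *)
Lemma cinf_symmetry_frame_scale {U} {r : nat} {Z : 'I_r -> vfield R n} {X}
    {f : E -> R} : open U -> smooth U f -> (forall x, U x -> f x != 0) ->
  cinf_symmetry_frame U Z X -> cinf_symmetry_frame U Z (vf_scale f X).
Proof.
move=> oU sf f0 [sX iX vX].
split; first exact: vf_scale_smooth.
  rewrite extend_scale; apply: independent_on_scale iX => i x Ux.
  by case: fintype.split => _; [exact: oner_neq0|exact: f0].
rewrite extend_scale (span_vf_scale oU _ _); first exact: vX.
  by move=> i; case: fintype.split => _; [exact: smooth_cst|exact: sf].
by move=> i x Ux; case: fintype.split => _; [exact: oner_neq0|exact: f0].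
Qed.

(* The projection along [X] of a coordinate field. *)
Lemma annihilator_coord {U w X} k : open U -> smooth_form1 U w ->
  smooth_vfield U X -> (forall x, U x -> interior_product X w x = 1) ->
  annihilator U w (fun x => delta_mx 0 k - w x k 0 *: X x).
Proof.
move=> oU sw sX Xw; split=> [i|x Ux].
  rewrite (_ : (fun _ => _) =
      fun x => (delta_mx 0 k : E) 0 i - w x k 0 * X x 0 i).
    exact: (smoothB oU (smooth_cst _) (smoothM oU (sw k) (sX i))).
  by apply/funext => x; rewrite !mxE.
rewrite /interior_product.
under eq_bigr => i _ do rewrite !mxE mulrBl -mulrA.
rewrite sumrB -mulr_sumr -/(interior_product X w x) Xw// mulr1.
rewrite (bigD1 k)//= big1 => [|i ik]; last by rewrite (negbTE ik) mul0r.
by rewrite eqxx mul1r addr0 subrr.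
Qed.

End Distributions.

Theorem lemma2p1 (R : realType) (n : nat) (U : set 'rV[R]_n)
    (omega : form1 R n) (X : vfield R n)
    (U_open : open U) (U_star : star_shaped U)
    (omega_smooth : smooth_form1 U omega)
    (omega_neq0 : forall x, U x -> omega x != 0)
    (omega_frob : frobenius_integrable U omega)
    (X_sym : cinf_symmetry U (annihilator U omega) X)
    (X_omega : forall x, U x -> interior_product X omega x = 1)
    (f : 'rV[R]_n -> R)
    (f_smooth : smooth U f) (f_neq0 : forall x, U x -> f x != 0) :
  symmetrizing_factor U (annihilator U omega) X f <->
  integrating_factor U omega (fun x => (f x)^-1).
Proof.
have fV_smooth := smoothV U_open f_smooth f_neq0.
pose eta : form1 R n := fun x => (f x)^-1 *: omega x.
pose Y := vf_scale f X.
have [r0 [Z0 [dist0 frame0]]] := X_sym; have [X_smooth _ _] := frame0.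
have Y_smooth : smooth_vfield U Y := vf_scale_smooth U_open f_smooth X_smooth.
have eta_smooth : smooth_form1 U eta.
  move=> i; rewrite (_ : (fun _ => _) = fun x => (f x)^-1 * omega x i 0).
    exact: (smoothM U_open fV_smooth (omega_smooth i)).
  by apply/funext => x; rewrite mxE.
have Y_eta x : U x -> interior_product Y eta x = 1.
  move=> Ux; rewrite interior_product_scaler interior_product_scalel.
  by rewrite X_omega// mulr1 mulVf// f_neq0.
(* The matrix product is [d eta (Y, Z)]. The constant [c] is left free because the identity is used
   both for [Z = Y], with [c = 1], and for fields of the annihilator, with [c = 0]. *)
have d1_eta (Z : vfield R n) (c : R) x : smooth_vfield U Z ->
    (forall y, U y -> interior_product Z eta y = c) -> U x ->
    Y x *m d1 eta x *m (Z x)^T =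
    (- interior_product (lie_bracket Y Z) eta x)%:M.
  move=> Z_smooth Z_eta Ux; rewrite [LHS]mx11_scalar; congr _%:M.
  transitivity (\sum_i \sum_j Y x 0 i * Z x 0 j * d1 eta x i j).
    rewrite exchange_big mxE; apply: eq_bigr => j _; rewrite !mxE mulr_suml.
    by apply: eq_bigr => i _; rewrite mulrAC.
  rewrite (d1_cartan U_open eta_smooth Y_smooth Z_smooth Ux).
  rewrite (vf_apply_cst c U_open Ux Z_eta) (vf_apply_cst 1 U_open Ux Y_eta).
  by rewrite subrr sub0r.
have eta_ann (Z : vfield R n) x : annihilator U omega Z -> U x ->
    interior_product Z eta x = 0.
  by move=> [_ Zw] Ux; rewrite interior_product_scaler Zw// mulr0.
split.
  (* The frame [Z] witnessing the symmetry may differ from [Z0]; all that matters is that it spans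
     the annihilator. *)
  move=> [_ _ [r [Z [[_ Z_smooth _ DZ _] _ YZ]]]].
  split=> // [x Ux|]; first by rewrite invr_eq0 f_neq0.
  apply: (poincare U_open U_star eta_smooth) => x Ux.
  have alt i j : d1 eta x i j = - d1 eta x j i by rewrite !mxE opprB.
  have ZD k : annihilator U omega (Z k) by rewrite DZ; exact: span_vf_frame.
  apply: (two_form_eq0 alt _ (Y_eta x Ux)).
    exact: (frobenius_scale fV_smooth omega_smooth omega_frob x Ux).
  (* Since [[Y, Y] = 0], Cartan's formula gives [d eta (Y, Y) = 0]; the factor [f x] is then divided
     out. *)
  have YX : Y x *m d1 eta x *m (X x)^T = 0.
    have : Y x *m d1 eta x *m (Y x)^T = 0.
      rewrite (d1_eta Y 1 x Y_smooth Y_eta Ux).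
      rewrite (_ : lie_bracket Y Y = fun=> 0); last first.
        by apply/funext => y; apply/rowP => j; rewrite !mxE subrr.
      rewrite /interior_product big1 ?oppr0 ?raddf0// => j _.
      by rewrite mxE mul0r.
    move=> /eqP; rewrite /Y /vf_scale linearZ/= -scalemxAr scaler_eq0.
    by rewrite (negbTE (f_neq0 x Ux)) => /eqP.
  have YZ0 k : Y x *m d1 eta x *m (Z k x)^T = 0.
    rewrite (d1_eta (Z k) 0 x (Z_smooth k) (fun y => eta_ann _ _ (ZD k)) Ux).
    have [c _ cE] := YZ k.
    rewrite (interior_product_comb eta _ x (cE x Ux)).
    rewrite big1 ?oppr0 ?raddf0// => l _.
    by rewrite (eta_ann _ _ (ZD l) Ux) mulr0.
  (* The k-th coordinate field is a combination of the [Z_l] plus [omega_k X], and [Y _| d eta] has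
     just been shown to vanish on each of these fields. *)
  apply/rowP => k; rewrite [RHS]mxE.
  have := annihilator_coord k U_open omega_smooth X_smooth X_omega.
  rewrite DZ => -[a _ /(_ x Ux)/eqP]; rewrite subr_eq => /eqP coordE.
  transitivity ((Y x *m d1 eta x *m (delta_mx 0 k : 'rV[R]_n)^T) 0 0).
    by rewrite trmx_delta -colE [RHS]mxE.
  rewrite coordE linearD linearZ linear_sum/= mulmxDr mulmx_sumr.
  rewrite -scalemxAr YX scaler0 addr0 big1 ?mxE// => l _.
  by rewrite linearZ/= -scalemxAr YZ0 scaler0.
move=> [_ _ [F F_smooth eta_F]]; split=> //.
exists r0, Z0; split; [exact: dist0|exact: cinf_symmetry_frame_scale|].
move=> i; have [_ Z_smooth _ DZ _] := dist0.
have ZD : annihilator U omega (Z0 i) by rewrite DZ; exact: span_vf_frame.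
(* Once the bracket is in the annihilator, [DZ] supplies the smooth coefficients [c], with no [Y]
   component. *)
have : annihilator U omega (lie_bracket Y (Z0 i)).
  split=> [|x Ux].
    exact: (lie_bracket_smooth U_open Y_smooth (Z_smooth i)).
  apply: (mulfI (_ : (f x)^-1 != 0)); first by rewrite invr_eq0 f_neq0.
  rewrite mulr0 -(interior_product_scaler (fun y => (f y)^-1)).
  have := d1_eta (Z0 i) 0 x (Z_smooth i) (fun y => eta_ann _ _ ZD) Ux.
  rewrite (d1_d0 U_open F_smooth eta_F x Ux) mulmx0 mul0mx.
  by move=> /matrixP/(_ 0 0)/eqP; rewrite !mxE eqxx eq_sym oppr_eq0 => /eqP.
by rewrite DZ => -[c c_smooth cE]; exists c.
Qed.
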